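(* Let $1\le k\le n$, let $A\in\mathbb{R}^{n\times n}$ be symmetric and nonsingular, and let $J\in\mathbb{R}^{k\times k}$ be symmetric with $J^2=I_k$. Let $X\mapsto \mathbf{M}_X$ be a map assigning to each $X\in\mathrm{iSt}_{A,J}(k,n)$ a symmetric positive-definite matrix $\mathbf{M}_X\in\mathbb{R}^{n\times n}$ depending smoothly on $X$. Let $X\in\mathrm{iSt}_{A,J}(k,n)$ and $Y\in\mathbb{R}^{n\times k}$. Then the orthogonal projections of $Y$, with respect to $\mathrm{g}_{\mathbf{M}_X}$, onto the tangent space $T_X\mathrm{iSt}_{A,J}(k,n)$ and onto the normal space $T_X\mathrm{iSt}_{A,J}(k,n)^{\perp}_{\mathrm{g}_{\mathbf{M}_X}}$ are, respectively, $$\mathcal{P}_X^{\mathbf{M}_X}(Y)=Y-\mathbf{M}_X^{-1}AXU_{X,Y}\quad\text{and}\quad \mathcal{P}_X^{\perp_{\mathbf{M}_X}}(Y)=\mathbf{M}_X^{-1}AXU_{X,Y},$$ where $U_{X,Y}$ is the solution to the Lyapunov equation $$(X^TA\mathbf{M}_X^{-1}AX)U+U(X^TA\mathbf{M}_X^{-1}AX)=2\,\mathrm{sym}(X^TAY)$$ with unknown $U\in\mathbb{R}^{k\times k}$.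
   Context: $\mathrm{iSt}_{A,J}(k,n)=\{X\in\mathbb{R}^{n\times k} : X^TAX=J\}$ is the indefinite Stiefel manifold, an embedded submanifold of $\mathbb{R}^{n\times k}$ whenever nonempty, with tangent space $T_X\mathrm{iSt}_{A,J}(k,n)=\{Z\in\mathbb{R}^{n\times k}: Z^TAX+X^TAZ=0\}$. The inner product on $\mathbb{R}^{n\times k}$ is $\mathrm{g}_{\mathbf{M}_X}(Z_1,Z_2)=\mathrm{tr}(Z_1^T\mathbf{M}_XZ_2)$. The normal space $T_X\mathrm{iSt}_{A,J}(k,n)^{\perp}_{\mathrm{g}_{\mathbf{M}_X}}$ is the orthogonal complement of $T_X\mathrm{iSt}_{A,J}(k,n)$ in $\mathbb{R}^{n\times k}$ with respect to $\mathrm{g}_{\mathbf{M}_X}$. Writing $Y=Y_1+Y_2$ uniquely with $Y_1$ in the tangent space and $Y_2$ in the normal space, the projections are $\mathcal{P}_X^{\mathbf{M}_X}(Y)=Y_1$ and $\mathcal{P}_X^{\perp_{\mathbf{M}_X}}(Y)=Y_2$. For a square matrix $\Omega$, $\mathrm{sym}(\Omega)=\frac12(\Omega+\Omega^T)$. *)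

(* Defs.v *)
From mathcomp Require Import all_boot all_order all_algebra.
From mathcomp Require Import all_classical all_reals all_analysis.

Set Implicit Arguments.
Unset Strict Implicit.
Unset Printing Implicit Defensive.

Import Order.TTheory GRing.Theory Num.Theory numFieldNormedType.Exports.
Local Open Scope classical_set_scope.
Local Open Scope ring_scope.

(* Meaningful for [O] open. In finite dimension, having continuous iterated
   directional derivatives of all orders up to [r] is the usual class C^r. *)
Fixpoint class_C (R : realType) (V W : normedModType R) (r : nat)
    (O : set V) (f : V -> W) : Prop :=
  (forall x, O x -> {for x, continuous f}) /\
  if r is r'.+1 then
    forall v : V, (forall x, O x -> derivable f x v) /\ class_C r' O ('D_v f)
  else True.

(* Only the values of [f] on [S] matter: [f] is smooth on the (embedded)
   submanifold [S] when it extends, around every point of [S], to a C^oo map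
   on an open set of the ambient space. *)
Definition smooth_on (R : realType) (V W : normedModType R)
    (S : set V) (f : V -> W) : Prop :=
  forall x, S x -> exists (O : set V) (g : V -> W),
    [/\ open O, O x, (forall r, class_C r O g)
      & forall y, S y -> O y -> g y = f y].

Section IndefiniteStiefel.
Variables (R : realType) (n k : nat).

Definition iSt (A : 'M[R]_n) (J : 'M[R]_k) : set 'M[R]_(n, k) :=
  [set X | X^T *m A *m X = J].

Definition tangent_space (A : 'M[R]_n) (X : 'M[R]_(n, k)) :
    set 'M[R]_(n, k) :=
  [set Z | Z^T *m A *m X + X^T *m A *m Z = 0].

Definition symmetric_mx m (B : 'M[R]_m) : Prop := B^T = B.

Definition posdef_mx m (B : 'M[R]_m) : Prop :=
  forall v : 'cV[R]_m, v != 0 -> 0 < (v^T *m B *m v) 0 0.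

Definition inner (M : 'M[R]_n) (Z1 Z2 : 'M[R]_(n, k)) : R :=
  \tr (Z1^T *m M *m Z2).

Definition orth_compl (M : 'M[R]_n) (T : set 'M[R]_(n, k)) :
    set 'M[R]_(n, k) :=
  [set N | forall Z, T Z -> inner M N Z = 0].

Definition normal_space (A M : 'M[R]_n) (X : 'M[R]_(n, k)) :
    set 'M[R]_(n, k) :=
  orth_compl M (tangent_space A X).

(* [Y1] and [Y2] are the tangent and normal projections of [Y] at [X]:
   [Y = Y1 + Y2] is the one and only decomposition of [Y] into a tangent and
   a normal component. *)
Definition projections (A M : 'M[R]_n) (X Y Y1 Y2 : 'M[R]_(n, k)) : Prop :=
  unique (fun p : 'M[R]_(n, k) * 'M[R]_(n, k) =>
    [/\ tangent_space A X p.1, normal_space A M X p.2 & Y = p.1 + p.2])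
  (Y1, Y2).

Definition sym_part m (B : 'M[R]_m) : 'M[R]_m := 2^-1 *: (B + B^T).

Definition lyapunov (A M : 'M[R]_n) (X Y : 'M[R]_(n, k)) (U : 'M[R]_k) : Prop :=
  let L := X^T *m A *m invmx M *m A *m X in
  L *m U + U *m L = 2 *: sym_part (X^T *m A *m Y).

End IndefiniteStiefel.

(* Main.v *)
Require Import Defs.
From mathcomp Require Import all_boot all_order all_algebra.
From mathcomp Require Import all_classical all_reals all_analysis.
Import Order.TTheory GRing.Theory Num.Theory numFieldNormedType.Exports.
Local Open Scope classical_set_scope.
Local Open Scope ring_scope.

(* With B = A X and W = M^-1, a vector W B U with U symmetric is normal, and
   Y - W B U is tangent exactly when U solves the Lyapunov equation for
   L = B^T W B. Since X^T B = J is invertible, B is injective, so L is positive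
   definite. Pairing L U + U L = 0 with U then gives U = 0, so the Lyapunov
   operator is injective, hence bijective by dimension; by uniqueness its
   solution for a symmetric right-hand side is symmetric. *)

(** Positive definiteness is stated for column vectors; splitting the trace over the columns of [Z]
    carries it over to trace forms of matrices. *)
Lemma mxtrace_congr (R : realType) m p (B : 'M[R]_m) (Z : 'M[R]_(m, p)) :
  \tr (Z^T *m B *m Z) = \sum_j ((col j Z)^T *m B *m col j Z) 0 0.
Proof.
apply: eq_bigr => j _; rewrite !mxE; apply: eq_bigr => i _; rewrite !mxE.
by congr (_ * _); apply: eq_bigr => l _; rewrite !mxE.
Qed.

Section PositiveDefinite.
Context {R : realType} {m : nat} {B : 'M[R]_m}.
Hypothesis B_pos : posdef_mx B.

Lemma posdef_mx_ge0 (v : 'cV[R]_m) : 0 <= (v^T *m B *m v) 0 0.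
Proof.
have [->|v0] := eqVneq v 0; first by rewrite mulmx0 mxE.
exact/ltW/B_pos.
Qed.

Lemma posdef_mxtrace_ge0 p (Z : 'M[R]_(m, p)) : 0 <= \tr (Z^T *m B *m Z).
Proof. by rewrite mxtrace_congr sumr_ge0// => j _; exact: posdef_mx_ge0. Qed.

Lemma posdef_mxtrace_eq0 p (Z : 'M[R]_(m, p)) :
  \tr (Z^T *m B *m Z) = 0 -> Z = 0.
Proof.
rewrite mxtrace_congr => /eqP; rewrite psumr_eq0; last first.
  by move=> j _; exact: posdef_mx_ge0.
move=> /allP Z0; apply/matrixP => i j; rewrite [RHS]mxE.
have [/colP/(_ i)|/B_pos] := eqVneq (col j Z) 0; first by rewrite !mxE.
by have /eqP -> := Z0 j (mem_index_enum _); rewrite ltxx.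
Qed.

Lemma posdef_unitmx : B \in unitmx.
Proof.
(* A row [v] with [v *m B = 0] makes the trace form of [B] vanish at [v^T]. *)
rewrite -row_free_unit; apply: inj_row_free => v vB0.
by apply/trmx_inj; rewrite trmx0; apply: posdef_mxtrace_eq0;
   rewrite trmxK vB0 mul0mx mxtrace0.
Qed.

Lemma posdef_congr p (Z : 'M[R]_(m, p)) :
  (forall v : 'cV[R]_p, Z *m v = 0 -> v = 0) -> posdef_mx (Z^T *m B *m Z).
Proof.
move=> Z_inj v v0; have := B_pos (Z *m v); rewrite trmx_mul !mulmxA; apply.
by apply: contra_neq v0; exact: Z_inj.
Qed.

(** Multiplying by [U^T] and taking traces gives tr(U^T B U) + tr(U B U^T) = 0. Both terms are
    nonnegative, so the first one vanishes. *)
Lemma lyapunov_ker (U : 'M[R]_m) : B *m U + U *m B = 0 -> U = 0.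
Proof.
move=> /(congr1 (fun V => \tr (U^T *m V))); rewrite mulmx0 mxtrace0.
rewrite mulmxDr mxtraceD [in X in _ + X]mxtrace_mulC !mulmxA.
have := posdef_mxtrace_ge0 _ U^T; rewrite trmxK => t2 /eqP.
rewrite -[X in _ + X]mxtrace_mulC mulmxA paddr_eq0 ?posdef_mxtrace_ge0//.
  by move=> /andP[/eqP/posdef_mxtrace_eq0].
by rewrite -mulmxA mxtrace_mulC.
Qed.

Lemma lyapunov_onto (C : 'M[R]_m) : exists U, B *m U + U *m B = C.
Proof.
(* [G] is the square matrix of the Lyapunov operator acting on vectorized matrices, so a trivial
   kernel makes it invertible. *)
pose G := lin_mulmx B + lin_mulmxr B.
have mxvecG (U : 'M[R]_m) : mxvec U *m G = mxvec (B *m U + U *m B).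
  by rewrite mulmxDr !mul_vec_lin linearD.
have G_unit : G \in unitmx.
  rewrite -row_free_unit; apply: inj_row_free => v.
  rewrite -[v]vec_mxK mxvecG => /eqP; rewrite mxvec_eq0 => /eqP/lyapunov_ker ->.
  by rewrite linear0.
exists (vec_mx (mxvec C *m invmx G)); apply: (can_inj mxvecK).
by rewrite -mxvecG vec_mxK mulmxKV.
Qed.

End PositiveDefinite.

Lemma symmetric_invmx (R : realType) m (B : 'M[R]_m) :
  symmetric_mx B -> symmetric_mx (invmx B).
Proof. by rewrite /symmetric_mx trmx_inv => ->. Qed.

Lemma posdef_invmx (R : realType) m (B : 'M[R]_m) :
  symmetric_mx B -> posdef_mx B -> posdef_mx (invmx B).
Proof.
move=> B_sym B_pos; have B_unit := posdef_unitmx B_pos.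
(* By symmetry the inverse is itself a congruence transform of [B]. *)
have -> : invmx B = (invmx B)^T *m B *m invmx B.
  by rewrite (symmetric_invmx _ _ _ B_sym) mulVmx// mul1mx.
apply: posdef_congr => // v; move/(congr1 (mulmx B)).
by rewrite mulmx0 mulKVmx.
Qed.

(* Transposing the equation shows that [U^T] is another solution. *)
Lemma lyapunov_sym (R : realType) m (B C U : 'M[R]_m) : posdef_mx B ->
  symmetric_mx B -> symmetric_mx C -> B *m U + U *m B = C -> symmetric_mx U.
Proof.
move=> B_pos B_sym C_sym UE; apply/subr0_eq/(lyapunov_ker B_pos).
have : B *m U^T + U^T *m B = C.
  by rewrite -C_sym -UE linearD /= !trmx_mul B_sym addrC.
by rewrite -{1}UE mulmxBr mulmxBl addrACA -opprD => ->; rewrite UE subrr.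
Qed.

Lemma tangent_normal_eq0 (R : realType) n k (A M : 'M[R]_n)
    (X Z : 'M[R]_(n, k)) :
  posdef_mx M -> tangent_space A X Z -> Defs.normal_space A M X Z -> Z = 0.
(* Such a [Z] is orthogonal to itself. *)
Proof. by move=> M_pos tZ /(_ _ tZ); exact: posdef_mxtrace_eq0. Qed.

Lemma tangent_spaceB (R : realType) n k (A : 'M[R]_n) (X Z1 Z2 : 'M[R]_(n, k)) :
  tangent_space A X Z1 -> tangent_space A X Z2 -> tangent_space A X (Z1 - Z2).
Proof.
rewrite /tangent_space /= => t1 t2.
by rewrite linearB /= !mulmxBl mulmxBr addrACA -opprD t1 t2 subrr.
Qed.

Lemma normal_spaceB (R : realType) n k (A M : 'M[R]_n)
    (X N1 N2 : 'M[R]_(n, k)) : Defs.normal_space A M X N1 ->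
  Defs.normal_space A M X N2 -> Defs.normal_space A M X (N1 - N2).
Proof.
move=> n1 n2 Z tZ; rewrite /inner linearB /= !mulmxBl linearB /=.
by have := n1 Z tZ; have := n2 Z tZ; rewrite /inner => -> ->; rewrite subrr.
Qed.

Lemma projectionsP (R : realType) n k (A M : 'M[R]_n)
    (X Y1 Y2 : 'M[R]_(n, k)) : posdef_mx M ->
  tangent_space A X Y1 -> Defs.normal_space A M X Y2 ->
  projections A M X (Y1 + Y2) Y1 Y2.
Proof.
move=> M_pos tY1 nY2; split=> // -[Z1 Z2] [/= tZ1 nZ2 YE].
(* The difference of two decompositions is both tangent and normal, hence zero. *)
have DE : Y1 - Z1 = Z2 - Y2.
  by apply/eqP; rewrite subr_eq addrAC -subr_eq opprK YE addrC.
have D0 : Y1 - Z1 = 0.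
  apply: (tangent_normal_eq0 _ _ _ A _ X _ M_pos); first exact: tangent_spaceB.
  by rewrite DE; exact: normal_spaceB.
by move: DE; rewrite D0 => /esym/subr0_eq ->; rewrite (subr0_eq D0).
Qed.

(* For tangent [Z], [X^T *m A *m Z] is skew, hence trace-orthogonal to [U]. *)
Lemma normal_space_sym (R : realType) n k (A M : 'M[R]_n) (X : 'M[R]_(n, k))
    (U : 'M[R]_k) : symmetric_mx A -> symmetric_mx M -> M \in unitmx ->
  symmetric_mx U -> Defs.normal_space A M X (invmx M *m A *m X *m U).
Proof.
move=> A_sym M_sym M_unit U_sym Z; rewrite /tangent_space /= => tZ.
rewrite /inner !trmx_mul (symmetric_invmx _ _ _ M_sym) A_sym U_sym !mulmxA.
rewrite mulmxKV//.
have trE : \tr (U *m X^T *m A *m Z) = \tr (U *m (Z^T *m A *m X)).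
  rewrite -[LHS]mxtrace_tr !trmx_mul A_sym U_sym trmxK !mulmxA.
  by rewrite mxtrace_mulC !mulmxA.
have /eqP := congr1 (fun V => \tr (U *m V)) tZ.
rewrite mulmxDr mxtraceD -trE !mulmxA mulmx0 mxtrace0 -mulr2n.
by rewrite mulrn_eq0 => /eqP.
Qed.

Theorem proposition3p2 (R : realType) (n k : nat)
  (k_ge1 : (1 <= k)%N) (k_le_n : (k <= n)%N)
  (A : 'M[R]_n) (A_sym : symmetric_mx A) (A_unit : A \in unitmx)
  (J : 'M[R]_k) (J_sym : symmetric_mx J) (J_sq : J *m J = 1%:M)
  (M : 'M[R]_(n, k) -> 'M[R]_n)
  (M_sym : forall X, iSt A J X -> symmetric_mx (M X))
  (M_pos : forall X, iSt A J X -> posdef_mx (M X))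
  (M_smooth : smooth_on (iSt A J) M)
  (X : 'M[R]_(n, k)) (X_iSt : iSt A J X) (Y : 'M[R]_(n, k)) :
  exists U : 'M[R]_k,
    unique (lyapunov A (M X) X Y) U /\
    projections A (M X) X Y
      (Y - invmx (M X) *m A *m X *m U)
      (invmx (M X) *m A *m X *m U).
Proof.
have {}M_sym := M_sym X X_iSt; have {}M_pos := M_pos X X_iSt.
have M_unit := posdef_unitmx M_pos.
have W_sym := symmetric_invmx _ _ _ M_sym.
pose L := X^T *m A *m invmx (M X) *m A *m X.
have L_pos : posdef_mx L.
  have -> : L = (A *m X)^T *m invmx (M X) *m (A *m X).
    by rewrite trmx_mul A_sym !mulmxA.
  apply: posdef_congr; first exact: posdef_invmx.
  (* [J *m X^T] is a left inverse of [A *m X], since J X^T A X = J^2 = I. *)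
  move=> v /(congr1 (fun w => J *m (X^T *m w))).
  by rewrite [X^T *m (_ *m v)]mulmxA [X^T *m _]mulmxA X_iSt mulmxA J_sq mul1mx
     !mulmx0.
have L_sym : symmetric_mx L.
  by rewrite /symmetric_mx !trmx_mul trmxK A_sym W_sym !mulmxA.
pose C := 2 *: sym_part (X^T *m A *m Y).
(* [C] is the left side of the tangency condition evaluated at [Y]. *)
have CE : C = X^T *m A *m Y + Y^T *m A *m X.
  by rewrite /C /sym_part scalerA divff// scale1r !trmx_mul trmxK A_sym !mulmxA.
have C_sym : symmetric_mx C.
  by rewrite CE /symmetric_mx linearD /= !trmx_mul !trmxK A_sym !mulmxA addrC.
have [U UE] := lyapunov_onto L_pos C.
have U_sym := lyapunov_sym _ _ _ _ _ L_pos L_sym C_sym UE.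
exists U; split.
  split=> // V; rewrite /lyapunov -/L -/C => VE.
  apply/subr0_eq/(lyapunov_ker L_pos).
  by rewrite mulmxBr mulmxBl addrACA -opprD VE UE subrr.
rewrite -{1}[Y](subrK (invmx (M X) *m A *m X *m U)).
apply: projectionsP => //; last exact: normal_space_sym.
(* As [U] is symmetric, the normal candidate contributes U L + L U to the tangency condition, which
   cancels [C] by [UE]. *)
rewrite /tangent_space /= linearB /= !trmx_mul A_sym W_sym U_sym.
rewrite !mulmxBl mulmxBr addrACA -opprD [Y^T *m A *m X + _]addrC -CE !mulmxA.
by rewrite -UE /L !mulmxA addrC [X in - X + _]addrC addNr.
Qed.
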